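(* Let $d\geq 2$ be a constant. There is a randomized algorithm (always returning the correct answer) that solves rooted Subtree Isomorphism on two rooted trees $H$ and $G$, each with $O(n)$ vertices, in which every vertex has at most $d$ children, and of height at most $h$, in expected time $$O\left(\min\left\{\left(d^2-\tfrac{1}{3}d+\tfrac{2}{3}\right)^h, n^2\right\}\right).$$ In particular, for every constant $\epsilon>0$ the algorithm runs in expected time $O(n^{2-\delta})$ for some constant $\delta>0$ on trees of height $$h\leq\left(\frac{\log(d^2)}{\log(d^2-\frac13 d+\frac23)}-\epsilon\right)\cdot\log_d n.$$
   Context: Rooted Subtree Isomorphism: given rooted unordered trees $H$ and $G$, decide whether $H$ is isomorphic to a subtree of $G$, i.e. whether there is an injective map $f$ from the vertices of $H$ to the vertices of $G$ with $f(\mathrm{root}(H))=\mathrm{root}(G)$ such that whenever $c$ is a child of $p$ in $H$, $f(c)$ is a child of $f(p)$ in $G$. The height of a rooted tree is the maximum number of edges on a root-to-leaf path. *)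

(* Defs.v *)
From mathcomp Require Import all_boot all_order all_algebra.
From mathcomp Require Import all_classical all_reals all_analysis.

Set Implicit Arguments.
Unset Strict Implicit.
Unset Printing Implicit Defensive.
Import Order.TTheory GRing.Theory Num.Theory.

(* Rooted trees.  The order inside [children v] only reflects how the tree is
   presented to an algorithm: [subtree_iso] does not depend on it. *)

Record rooted_tree := RootedTree {
  nv : nat;
  root : 'I_nv;
  children : 'I_nv -> seq 'I_nv;
  children_uniq : forall v, uniq (children v);
  root_no_parent : forall v, root \notin children v;
  parent_unique : forall p q v,
    v \in children p -> v \in children q -> p = q;
  root_connect : forall v, connect (grel children) root v
}.

Definition child (T : rooted_tree) : rel 'I_(nv T) :=
  fun p c => c \in children p.

Definition max_children (d : nat) (T : rooted_tree) : Prop :=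
  forall v : 'I_(nv T), size (children v) <= d.

Definition height_le (h : nat) (T : rooted_tree) : Prop :=
  forall p : seq 'I_(nv T), path (@child T) (root T) p ->
    children (last (root T) p) = [::] -> size p <= h.

Definition subtree_iso (H G : rooted_tree) : Prop :=
  exists f : 'I_(nv H) -> 'I_(nv G),
    [/\ injective f, f (root H) = root G
      & forall p c, child p c -> child (f p) (f c)].

(* A randomized random-access machine with unit-cost instructions.  A register
   can only be set to a constant, a random number below a constant, a loaded
   cell, or another register shifted by a constant; after t steps every number
   in the machine is therefore bounded by the largest initial number plus O(t),
   so that charging one unit per instruction does not hide any
   super-logarithmic word length. *)

Inductive instr :=
  | Const of nat & nat
  | AddC of nat & nat & nat
  | SubC of nat & nat & nat
  | Read of nat & nat
  | Write of nat & nat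
  | Rand of nat & nat
  | Jump of nat
  | JumpR of nat
  | JumpEq of nat & nat & nat
  | JumpLt of nat & nat & nat
  | Halt of bool.

Definition program := seq instr.

Record config := Config { pc : nat; regs : nat -> nat; mem : nat -> nat }.

Definition upd (f : nat -> nat) (a x : nat) : nat -> nat :=
  fun i => if i == a then x else f i.

(* Leaving the program text counts as rejecting. *)
Definition cur_instr (P : program) (c : config) : instr :=
  nth (Halt false) P (pc c).

Definition set_reg (c : config) (r x : nat) : config :=
  Config (pc c).+1 (upd (regs c) r x) (mem c).

Definition goto (c : config) (l : nat) : config :=
  Config l (regs c) (mem c).

(* The list of equiprobable successors; it is empty exactly on [Halt]. *)
Definition step (P : program) (c : config) : seq config :=
  match cur_instr P c with
  | Const r k => [:: set_reg c r k]
  | AddC r s k => [:: set_reg c r (regs c s + k)]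
  | SubC r s k => [:: set_reg c r (regs c s - k)]
  | Read r s => [:: set_reg c r (mem c (regs c s))]
  | Write r s =>
      [:: Config (pc c).+1 (regs c) (upd (mem c) (regs c r) (regs c s))]
  | Rand r k => [seq set_reg c r i | i <- iota 0 k.+1]
  | Jump l => [:: goto c l]
  | JumpR r => [:: goto c (regs c r)]
  | JumpEq r s l =>
      [:: goto c (if regs c r == regs c s then l else (pc c).+1)]
  | JumpLt r s l =>
      [:: goto c (if regs c r < regs c s then l else (pc c).+1)]
  | Halt _ => [::]
  end.

Fixpoint run_to (P : program) (k : nat) (c c' : config) : Prop :=
  if k is k'.+1 then
    exists i, i < size (step P c) /\ run_to P k' (nth c (step P c) i) c'
  else c' = c.

Definition always_answers (P : program) (c : config) (A : Prop) : Prop :=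
  forall k c' b, run_to P k c c' -> cur_instr P c' = Halt b ->
    (b = true <-> A).

(* The probability that the run of [P] from [c] has not halted after [k]
   steps, the random choices being independent. *)
Fixpoint prob_running (R : realType) (P : program) (k : nat) (c : config)
    : R :=
  (if k is k'.+1 then
     (\sum_(c' <- step P c) prob_running R P k' c') / (size (step P c))%:R
   else (0 < size (step P c))%N%:R)%R.

(* E[T] = \sum_k Pr[T > k] for the number T of executed steps; it is +oo when
   the run fails to halt with positive probability. *)
Definition expected_time (R : realType) (P : program) (c : config) : \bar R :=
  (\sum_(0 <= k <oo) (prob_running R P k c)%:E)%E.

(* Input format: [loc v] is the address of the record of [v], which consists
   of the number of children of [v] followed by the addresses of the records
   of these children.  All addresses from [free] on are available as working
   space. *)

Definition stored (m : nat -> nat) (free : nat) (T : rooted_tree)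
    (loc : 'I_(nv T) -> nat) : Prop :=
  forall v : 'I_(nv T),
    [/\ loc v + size (children v) < free,
        m (loc v) = size (children v)
      & forall i, i < size (children v) ->
          m (loc v + i.+1) = loc (nth (root T) (children v) i)].

(* Registers 0 and 1 point to the roots of H and G, register 2 to the free
   space; the remaining registers and memory cells may hold anything. *)
Definition is_input (H G : rooted_tree) (c : config) : Prop :=
  pc c = 0 /\
  exists locH locG,
    [/\ @stored (mem c) (regs c 2) H locH,
        @stored (mem c) (regs c 2) G locG,
        regs c 0 = locH (root H)
      & regs c 1 = locG (root G)].

Definition growth (R : realType) (d : nat) : R :=
  (d%:R ^+ 2 - 3%:R^-1 * d%:R + 2%:R / 3%:R)%R.

(* Main.v *)
(* At a pair [(u, v)] with [a] and [b] children the program looks for a matching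
   that saturates the children of [u] in the bipartite graph whose edges are the
   pairs [(i, j)] such that the subtree below the [i]-th child of [u] embeds
   below the [j]-th child of [v]; every query of an edge is a recursive call.
   It stops as soon as the known edges contain such a matching or the known
   non-edges exclude one.

   If [a] and [b] are not both [d], at most [d (d - 1)] queries are made.  If
   [a = b = d], the rows are queried one after the other except that a random
   row [l] comes last, and is read forwards or backwards at random; with
   probability 1/2 rows and columns are exchanged.  When there is a perfect
   matching, nothing beyond the matched entry of row [l] is needed, which saves
   [(d - 1) / 2] queries on average.  Otherwise, by Hall's theorem, there is a
   zero block [R x S] with [#|R| + #|S| = d + 1]; it excludes a matching before
   row [l] is read if [l] is not in [R], and before the last column is read if
   that is not in [S].  The average saving is
   [((d - #|R|) + (d - #|S|)) / 2 = (d - 1) / 2] again, which is at least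
   [(d - 2) / 3].

   The random choices inside a recursive call are independent of whether the
   call is made, so the expected times satisfy [T (h + 1) <= growth * (T h + c)],
   whence the first bound.  Moreover a pair is reached only from the pair of the
   two parents and is queried at most once there, so that at most
   [nv H * nv G] pairs are ever visited, whence the second. *)

From HB Require Import structures.
Require Import Defs.
From mathcomp Require Import all_boot all_order all_algebra.
From mathcomp Require Import all_classical all_reals all_analysis.
From mathcomp Require Import fintype finset zify ring lra.
(* Again, because MathComp has another [root]. *)
Require Import Defs.

Set Implicit Arguments.
Unset Strict Implicit.
Unset Printing Implicit Defensive.
Import Order.TTheory GRing.Theory Num.Theory.

(** * Matchings *)

Section Hall.
Variables (T U : finType) (e : T -> U -> bool) (y0 : U).

Definition nbhd (A : {set T}) : {set U} := [set y | [exists x in A, e x y]].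

Lemma nbhdP (A : {set T}) y : reflect (exists2 x, x \in A & e x y) (y \in nbhd A).
Proof. by rewrite inE; apply: (iffP exists_inP). Qed.

Lemma nbhdU (A B : {set T}) : nbhd (A :|: B) = nbhd A :|: nbhd B.
Proof.
apply/setP=> y; rewrite in_setU; apply/nbhdP/orP => [[x]|[]/nbhdP[x xA exy]].
- by rewrite in_setU => /orP[] ? ?; [left|right]; apply/nbhdP; exists x.
- by exists x; rewrite // in_setU xA.
- by exists x; rewrite // in_setU xA orbT.
Qed.

(** Hall's theorem by strong induction on [#|X|], relative to [X] and [Y] so that vertices can be
    deleted without changing the types. Either a proper nonempty subset is tight and the problem
    splits there, or any edge can be matched and removed. *)
Lemma hall_in (X : {set T}) (Y : {set U}) :
  (forall A : {set T}, A \subset X -> #|A| <= #|nbhd A :&: Y|) ->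
  exists f : T -> U,
    {in X &, injective f} /\ {in X, forall x, f x \in Y /\ e x (f x)}.
Proof.
have [n] := ubnP #|X|; elim: n X Y => // n IHn X Y /ltnSE leXn hX.
have [->|[x xX]] := set_0Vmem X.
  by exists (fun=> y0); split=> [z t|z]; rewrite inE.
case: (boolP [exists A : {set T},
    [&& A != set0, A \proper X & #|nbhd A :&: Y| == #|A|]]) => [|noA].
  case/existsP=> A /and3P[A0 AX /eqP tA].
  have [sAX ltAX] := (proper_sub AX, proper_card AX).
  have [||f1 [if1 f1P]] := IHn A Y.
  - exact: leq_trans ltAX leXn.
  - by move=> B sBA; apply: hX; apply: subset_trans sAX.
  have [||f2 [if2 f2P]] := IHn (X :\: A) (Y :\: nbhd A).
  - apply: leq_trans leXn; rewrite cardsD (setIidPr sAX).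
    by rewrite ltn_subrL !card_gt0 A0 /=; apply/set0Pn; exists x.
  - move=> B; rewrite subsetD => /andP[sBX dBA].
    have := hX (A :|: B); rewrite subUset sAX sBX => /(_ isT).
    rewrite cardsU setIC (disjoint_setI0 dBA) cards0 subn0 nbhdU.
    have -> : (nbhd A :|: nbhd B) :&: Y =
              (nbhd A :&: Y) :|: (nbhd B :&: (Y :\: nbhd A)).
      apply/setP=> y; rewrite !inE; case: [exists _ in A, _].
        by rewrite /= !andbF orbF.
      by [].
    by move/leq_trans/(_ (leq_card_setU _ _)); rewrite tA leq_add2l.
  exists (fun z => if z \in A then f1 z else f2 z); split=> [y z yX zX|y yX].
    have XA w : w \in X -> w \notin A -> w \in X :\: A by rewrite inE => -> ->.
    case: ifPn => yA; case: ifPn => zA; first exact: if1.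
    - move=> E; have [/setDP[_]] := f2P z (XA z zX zA); rewrite -E.
      by case/nbhdP; exists y; rewrite ?(f1P y yA).2.
    - move=> E; have [/setDP[_]] := f2P y (XA y yX yA); rewrite E.
      by case/nbhdP; exists z; rewrite ?(f1P z zA).2.
    - by apply: if2; apply: XA.
  case: ifPn => yA; first exact: f1P.
  by have [|/setDP[? _]] := f2P y; rewrite ?inE ?yA.
have /set0Pn[y] : nbhd [set x] :&: Y != set0.
  by rewrite -card_gt0 (leq_trans _ (hX _ _)) ?cards1 ?sub1set.
rewrite inE => /andP[/nbhdP[_ /set1P-> exy] yY].
have [||f [if_ fP]] := IHn (X :\ x) (Y :\ y).
- by apply: leq_trans leXn; rewrite [ltnRHS](cardsD1 x) xX.
- move=> B sB; have [->|[z zB]] := set_0Vmem B; first by rewrite cards0.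
  have BX : B \proper X.
    apply/properP; split; first exact: subset_trans sB (subD1set _ _).
    by exists x => //; apply/negP => /(subsetP sB); rewrite !inE eqxx.
  (* No proper nonempty subset is tight, so there is a slack of one, which pays for the loss of
     [y]. *)
  have : #|B| < #|nbhd B :&: Y|.
    rewrite ltn_neqAle hX ?proper_sub // andbT eq_sym.
    apply: contra noA => tB; apply/existsP; exists B; rewrite BX tB !andbT.
    by apply/set0Pn; exists z.
  rewrite (cardsD1 y) => lt; rewrite -ltnS (leq_trans lt) //.
  rewrite -[leqRHS]add1n leq_add ?leq_b1 //.
  by apply/subset_leq_card/subsetP=> w; rewrite !inE; case/and3P=> -> -> ->.
exists (fun z => if z == x then y else f z); split=> [w z wX zX|w wX].
- have XA t : t \in X -> t != x -> t \in X :\ x by rewrite !inE => -> ->.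
  case: eqVneq => [->|wx]; case: eqVneq => [-> //|zx] E.
  + by have [] := fP z (XA z zX zx); rewrite -E !inE eqxx.
  + by have [] := fP w (XA w wX wx); rewrite E !inE eqxx.
  + by apply: if_; rewrite ?XA.
- case: eqVneq => [-> //|wx].
  by have [|/setD1P[_ ?] ?] := fP w; rewrite // !inE wx.
Qed.

End Hall.

Definition matchable (a b : nat) (M : nat -> nat -> bool) : bool :=
  [exists f : {ffun 'I_a -> 'I_b}, injectiveb f && [forall i : 'I_a, M i (f i)]].

Lemma matchableP a b (M : nat -> nat -> bool) :
  reflect (exists2 f : 'I_a -> 'I_b, injective f & forall i : 'I_a, M i (f i))
          (matchable a b M).
Proof.
apply: (iffP existsP) => [[f /andP[/injectiveP fi /forallP fM]]|[f fi fM]].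
  by exists f.
exists [ffun i => f i]; apply/andP; split.
  by apply/injectiveP=> i j; rewrite !ffunE; apply: fi.
by apply/forallP=> i; rewrite ffunE.
Qed.

Lemma sub_matchable a b (M N : nat -> nat -> bool) :
  (forall i j, i < a -> j < b -> M i j -> N i j) ->
  matchable a b M -> matchable a b N.
Proof.
move=> MN /matchableP[f fi fM]; apply/matchableP; exists f => // i.
by apply: MN.
Qed.

Lemma eq_matchable a b (M N : nat -> nat -> bool) :
  (forall i j, i < a -> j < b -> M i j = N i j) ->
  matchable a b M = matchable a b N.
Proof.
by move=> MN; apply/idP/idP; apply: sub_matchable => i j ia jb; rewrite MN.
Qed.

Lemma matchable_tr d (M : nat -> nat -> bool) :
  matchable d d (fun i j => M j i) = matchable d d M.
Proof.
suff tr N : matchable d d N -> matchable d d (fun i j => N j i).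
  by apply/idP/idP => /tr.
case/matchableP=> f fi fM; apply/matchableP; exists (invF fi).
  exact: can_inj (f_invF fi).
by move=> i; rewrite -{2}(f_invF fi i) fM.
Qed.

Lemma unmatchable_block d (M : nat -> nat -> bool) : ~~ matchable d d M ->
  exists R S : {set 'I_d}, #|R| + #|S| = d.+1 /\
    forall i j : 'I_d, i \in R -> j \in S -> ~~ M i j.
Proof.
case: d => [|d].
  case/matchableP; exists id => // -[] //.
move=> nM; pose e (i j : 'I_d.+1) := M i j.
case: (boolP [forall A : {set 'I_d.+1}, #|A| <= #|nbhd e A|]) => [/forallP h|].
  have [A _|f [fi fP]] := @hall_in _ _ e ord0 setT setT.
    by rewrite setIT.
  case/negP: nM; apply/matchableP; exists f => [i j|i].
    by apply: fi; rewrite inE.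
  by have [] := fP i; rewrite ?inE.
case/forallPn=> R; rewrite -ltnNge => ltR.
(* The set [R] violates Hall's condition; [take] trims the columns outside its neighbourhood to make
   the sizes add up exactly. The dimension is now [d.+1], whence [d.+2]. *)
exists R, [set j in take (d.+2 - #|R|) (enum (~: nbhd e R))]; split.
  have cR : #|R| <= d.+1 by rewrite (leq_trans (max_card _)) ?card_ord.
  have cN : #|nbhd e R| + #|~: nbhd e R| = d.+1 by rewrite cardsC card_ord.
  rewrite cardsE.
  move/card_uniqP: (take_uniq (d.+2 - #|R|) (enum_uniq (~: nbhd e R))) => ->.
  by rewrite size_take -cardE; case: ltnP; lia.
move=> i j iR; rewrite inE => /mem_take; rewrite mem_enum inE.
by apply: contra => Mij; apply/nbhdP; exists i.
Qed.

(** * Number of queries *)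

(** Unknown entries count as zeros in [lo] and as ones in [hi]; correct answers keep the actual
    matrix between the two. *)
Definition lo (kn : seq (nat * nat * bool)) (i j : nat) : bool :=
  ((i, j), true) \in kn.
Definition hi (kn : seq (nat * nat * bool)) (i j : nat) : bool :=
  ((i, j), false) \notin kn.

Definition decided (a b : nat) (kn : seq (nat * nat * bool)) : bool :=
  matchable a b (lo kn) || ~~ matchable a b (hi kn).

(* [kn] lists the entries queried so far with their values. *)
Fixpoint queries (a b : nat) (M : nat -> nat -> bool) (todo : seq (nat * nat))
    (kn : seq (nat * nat * bool)) : seq (nat * nat) :=
  if decided a b kn then [::]
  else if todo is q :: todo' then
    q :: queries a b M todo' ((q, M q.1 q.2) :: kn)
  else [::].

Lemma queries_take a b M todo kn :
  queries a b M todo kn = take (size (queries a b M todo kn)) todo.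
Proof.
elim: todo kn => [|q todo IH] kn /=; case: decided => //=.
by rewrite {1}IH.
Qed.

Lemma size_queries_le a b M todo kn :
  size (queries a b M todo kn) <= size todo.
Proof. by rewrite queries_take size_take; case: ltnP => // /ltnW. Qed.

Definition answers (M : nat -> nat -> bool) (s : seq (nat * nat)) :=
  [seq (q, M q.1 q.2) | q <- s].

Lemma size_queries_decided a b M todo kn p :
  decided a b (catrev (answers M (take p todo)) kn) ->
  size (queries a b M todo kn) <= p.
Proof.
elim: todo kn p => [|q todo IH] kn [|p] //=; try by move=> ->.
by move=> /IH; case: (decided a b kn).
Qed.

Lemma mem_answers M s i j e :
  (((i, j), e) \in answers M s) = ((i, j) \in s) && (e == M i j).
Proof.
apply/mapP/andP => [[[i' j'] qs [-> -> ->]] // |[qs /eqP->]].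
by exists (i, j).
Qed.

Lemma size_queries_yes a b M todo p :
  matchable a b (fun i j => ((i, j) \in take p todo) && M i j) ->
  size (queries a b M todo [::]) <= p.
Proof.
move=> h; apply: size_queries_decided; apply/orP; left.
apply: sub_matchable h => i j _ _ /andP[q Mij].
by rewrite /lo -/(rev _) mem_rev mem_answers q Mij.
Qed.

Lemma size_queries_no a b M todo p :
  ~~ matchable a b (fun i j => ((i, j) \in take p todo) ==> M i j) ->
  size (queries a b M todo [::]) <= p.
Proof.
move=> h; apply: size_queries_decided; apply/orP; right.
apply: contra h; apply: sub_matchable => i j _ _.
rewrite /hi -/(rev _) mem_rev mem_answers; case: (_ \in _) => //=.
by case: (M i j).
Qed.

Definition swap (q : nat * nat) : nat * nat := (q.2, q.1).
Definition swapk (x : nat * nat * bool) := (swap x.1, x.2).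

Lemma decided_tr d kn : decided d d (map swapk kn) = decided d d kn.
Proof.
have inj : injective swapk by move=> [[x y] e] [[x' y'] e'] [-> -> ->].
rewrite /decided; congr (_ || ~~ _); rewrite -[RHS]matchable_tr;
  apply: eq_matchable => i j _ _.
  by rewrite /lo -[RHS](mem_map inj).
by rewrite /hi -[in RHS](mem_map inj).
Qed.

(** Reduces column orders to row orders on the transposed matrix. *)
Lemma size_queries_tr d M todo kn :
  size (queries d d M (map swap todo) (map swapk kn)) =
  size (queries d d (fun i j => M j i) todo kn).
Proof.
elim: todo kn => [|[i j] todo IH] kn /=; rewrite decided_tr; case: decided => //=.
by rewrite -IH.
Qed.

(* Row [l] comes last and is read in the order [js]. *)
Definition row_order (d l : nat) (js : seq nat) : seq (nat * nat) :=
  [seq (i, j) | i <- rem l (iota 0 d), j <- iota 0 d] ++ [seq (l, j) | j <- js].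

Definition row_orders (d : nat) : seq (seq (nat * nat)) :=
  [seq row_order d l js | l <- iota 0 d, js <- [:: iota 0 d; rev (iota 0 d)]].

(* The second half queries column by column. *)
Definition orders (d a b : nat) : seq (seq (nat * nat)) :=
  if (a == d) && (b == d) then row_orders d ++ map (map swap) (row_orders d)
  else [:: [seq (i, j) | i <- iota 0 a, j <- iota 0 b]].

Section Rows.
Variables (d : nat) (M : nat -> nat -> bool).

Definition cost (o : seq (nat * nat)) := size (queries d d M o [::]).

Lemma take_row_order l js k : l < d ->
  take (d.-1 * d + k) (row_order d l js) =
  [seq (i, j) | i <- rem l (iota 0 d), j <- iota 0 d] ++
  [seq (l, j) | j <- take k js].
Proof.
move=> ld; rewrite /row_order take_cat size_allpairs size_rem ?mem_iota //.
by rewrite !size_iota ltnNge leq_addr /= addKn map_take.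
Qed.

Lemma mem_take_row_order l js k i j : l < d -> i < d -> j < d ->
  ((i, j) \in take (d.-1 * d + k) (row_order d l js)) =
  (i != l) || (j \in take k js).
Proof.
move=> ld id jd; rewrite take_row_order // mem_cat.
have inj : injective (pair l : nat -> nat * nat) by move=> x y [].
have [->|il] := eqVneq i l.
  rewrite (mem_map inj) /=; case: allpairsP => // -[[i' j'] [/= lr _ [li _]]].
  by rewrite -li mem_rem_uniqF ?iota_uniq in lr.
apply/orP; left; apply/allpairsP; exists (i, j) => /=; split=> //.
  by rewrite mem_rem_uniq ?iota_uniq // inE il mem_iota.
by rewrite mem_iota.
Qed.

Lemma big_row_orders (F : seq (nat * nat) -> nat) :
  \sum_(o <- row_orders d) F o =
  \sum_(l < d) (F (row_order d l (iota 0 d)) +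
                F (row_order d l (rev (iota 0 d)))).
Proof.
rewrite /row_orders big_allpairs_dep /=.
have -> : iota 0 d = index_iota 0 d by rewrite /index_iota subn0.
rewrite big_mkord.
by apply: eq_bigr => l _; rewrite !big_cons big_nil addn0.
Qed.

Lemma size_row_order l js : l < d -> size js = d ->
  size (row_order d l js) = d.-1 * d + d.
Proof.
move=> ld sj; rewrite size_cat size_allpairs size_rem ?mem_iota //.
by rewrite size_map sj !size_iota.
Qed.

(** Fix a matching [f]. Besides the other rows, reading row [l] forwards needs at most [f l + 1]
    entries and backwards at most [d - f l], together [d + 1] for every [l]. *)
Lemma cost_rows_yes : matchable d d M ->
  \sum_(o <- row_orders d) cost o <= d * (2 * (d.-1 * d) + d.+1).
Proof.
case/matchableP=> f fi fM; rewrite big_row_orders.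
rewrite -[X in _ <= X * _]card_ord -sum_nat_const; apply: leq_sum => l _.
have yes js k : (f l : nat) \in take k js ->
    cost (row_order d l js) <= d.-1 * d + k.
  move=> fl; apply: size_queries_yes; apply/matchableP; exists f => // i.
  rewrite mem_take_row_order // fM andbT.
  by have [->|il] := eqVneq i l; [rewrite fl orbT | rewrite -val_eqE in il; rewrite il].
have h1 : cost (row_order d l (iota 0 d)) <= d.-1 * d + (f l).+1.
  by apply: yes; rewrite take_iota mem_iota /= add0n leq_min ltnSn ltn_ord.
have h2 : cost (row_order d l (rev (iota 0 d))) <= d.-1 * d + (d - f l).
  apply: yes; rewrite take_rev mem_rev size_iota drop_iota mem_iota.
  by have := ltn_ord (f l); lia.
by have := ltn_ord (f l); lia.
Qed.

(** If [l] is outside [R], the zero block is known before row [l] is started; hence only the rows in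
    [R] can cost a further [d], in each direction. *)
Lemma cost_rows_no (R S : {set 'I_d}) : #|R| + #|S| = d.+1 ->
  (forall i j : 'I_d, i \in R -> j \in S -> ~~ M i j) ->
  \sum_(o <- row_orders d) cost o <= 2 * (d * (d.-1 * d) + d * #|R|).
Proof.
move=> cRS RS; rewrite big_row_orders.
have -> : 2 * (d * (d.-1 * d) + d * #|R|) =
    \sum_(l < d) 2 * (d.-1 * d + d * (l \in R)).
  rewrite -big_distrr big_split /= sum_nat_const card_ord.
  by rewrite -big_distrr /= -big_mkcond sum1_card.
apply: leq_sum => l _; rewrite mul2n -addnn.
suff h js : size js = d -> cost (row_order d l js) <= d.-1 * d + d * (l \in R).
  by rewrite leq_add // h ?size_rev ?size_iota.
move=> sj; case: (boolP (l \in R)) => lR.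
  by rewrite muln1 -(size_row_order (ltn_ord l) sj) ?size_queries_le.
apply: size_queries_no; apply/negP => /matchableP[f fi fM].
suff : [set f i | i in R] \subset ~: S.
  move/subset_leq_card; rewrite card_imset // -ltnS -(ltn_add2r #|S|).
  rewrite addSn cRS addnC cardsC card_ord => h; have := leq_trans h (leqnn _).
  by rewrite ltnn.
apply/subsetP=> _ /imsetP[i iR ->]; rewrite inE.
have := fM i; rewrite mem_take_row_order //.
have [il|_ /=] := eqVneq (i : nat) l.
  by rewrite (ord_inj il) (negPf lR) in iR.
by apply: contraTN => /(RS _ _ iR).
Qed.

End Rows.

(** With a matching, rows and columns each obey the same bound. Without one, the two halves
    contribute [#|R|] and [#|S|], and their sum [d + 1] leads to the same total. *)
Lemma sum_queries_square d M :
  \sum_(o <- orders d d d) size (queries d d M o [::]) <=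
  2 * (d * (2 * (d.-1 * d) + d.+1)).
Proof.
rewrite /orders !eqxx /= big_cat /= big_map.
under [X in _ + X]eq_bigr => o _ do
  rewrite -[[::]]/(map swapk [::]) size_queries_tr -/(cost d (fun i j => M j i) o).
under eq_bigr => o _ do rewrite -/(cost d M o).
have [yes|/unmatchable_block[R [S [cRS RS]]]] := boolP (matchable d d M).
  have := cost_rows_yes yes; move: yes; rewrite -matchable_tr => /cost_rows_yes.
  lia.
have h1 := cost_rows_no cRS RS.
have h2 := @cost_rows_no d (fun i j => M j i) S R (etrans (addnC _ _) cRS)
  (fun i j iS jR => RS j i jR iS).
by move: (cRS) h1 h2 => /(congr1 (muln d)); nia.
Qed.

Lemma size_orders d a b : size (orders d a b) = if (a == d) && (b == d) then 4 * d else 1.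
Proof.
rewrite /orders; case: ifP => // _.
by rewrite size_cat size_map /row_orders size_allpairs size_iota /=; lia.
Qed.

Lemma row_orders_pairs d o : o \in row_orders d ->
  uniq o /\ forall i j, ((i, j) \in o) = (i < d) && (j < d).
Proof.
case/allpairsP=> -[l js] [/=]; rewrite mem_iota /= add0n => ld hjs ->.
have [ujs mjs] : uniq js /\ forall j, (j \in js) = (j < d).
  move: hjs; rewrite !inE => /orP[] /eqP->; rewrite ?rev_uniq iota_uniq;
    by split=> // j; rewrite ?mem_rev mem_iota.
have inj : injective (pair l : nat -> nat * nat) by move=> x y [].
have memA i j : ((i, j) \in [seq (x, y) | x <- rem l (iota 0 d), y <- iota 0 d])
    = [&& i != l, i < d & j < d].
  apply/allpairsP/and3P => [[[x y] [/=]]|[il id jd]].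
    rewrite mem_rem_uniq ?iota_uniq // inE !mem_iota /= !add0n.
    by move=> /andP[? ?] [? [-> ->]].
  by exists (i, j); rewrite /= mem_rem_uniq ?iota_uniq // inE /= il !mem_iota.
have memB i j : ((i, j) \in [seq (l, y) | y <- js]) = (i == l) && (j < d).
  have [->|il] := eqVneq i l; first by rewrite (mem_map inj) mjs.
  by apply/negP => /mapP[y _ [E]]; rewrite E eqxx in il.
split.
  rewrite cat_uniq allpairs_uniq ?rem_uniq ?iota_uniq //; last by move=> [? ?] [? ?].
  rewrite (map_inj_uniq inj) ujs andbT; apply/hasPn => -[i j].
  by rewrite memB memA => /andP[/eqP-> _]; rewrite eqxx.
by move=> i j; rewrite mem_cat memA memB; have [->|] := eqVneq i l; rewrite ?ld ?orbF.
Qed.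

(** Exhaustiveness makes every test end decided; the absence of repetitions serves the quadratic
    time bound. *)
Lemma orders_pairs d a b o : o \in orders d a b ->
  uniq o /\ forall i j, ((i, j) \in o) = (i < a) && (j < b).
Proof.
have inj : injective swap by move=> [? ?] [? ?] [-> ->].
rewrite /orders; case: ifP => [/andP[/eqP-> /eqP->]|_].
  rewrite mem_cat => /orP[/row_orders_pairs|]; first by [].
  case/mapP=> o' /row_orders_pairs[u m] ->.
  split; first by rewrite map_inj_uniq.
  by move=> i j; rewrite -[(i, j)]/(swap (j, i)) (mem_map inj) m andbC.
rewrite inE => /eqP->; split.
  by apply: allpairs_uniq; rewrite ?iota_uniq // => -[? ?] [? ?].
move=> i j; apply/allpairsP/andP => [[[x y] [/=]]|[ia jb]].
  by rewrite !mem_iota /= !add0n => hx [hy [-> ->]].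
by exists (i, j); rewrite /= !mem_iota.
Qed.

(** The average over the [4 * d] orders of the square case is at most [d^2 - d/2 + 1/2]; otherwise
    there are at most [d * (d - 1)] queries. Both lie below [growth]. *)
Lemma sum_queries (R : realType) d a b M : 1 < d -> a <= d -> b <= d ->
  ((\sum_(o <- orders d a b) size (queries a b M o [::]))%:R <=
   growth R d * (size (orders d a b))%:R)%R.
Proof.
move=> d1 ad bd; rewrite size_orders; case: ifPn => [/andP[/eqP-> /eqP->]|ne].
  apply: (@le_trans _ _ (2 * (d * (2 * (d.-1 * d) + d.+1)))%:R%R).
    by rewrite ler_nat sum_queries_square.
  case: d d1 {ad bd} => // d d1 /=.
  have dR : (1 <= d%:R :> R)%R by rewrite ler1n.
  have dR1 : (d.+1%:R = d%:R + 1 :> R)%R by rewrite -natr1.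
  have dR2 : (d.+2%:R = d%:R + 2 :> R)%R by rewrite -natr1 dR1 -addrA.
  by rewrite /growth !(natrM, natrD) dR2 dR1; nra.
rewrite /orders (negPf ne) big_seq1 mulr1.
apply: (@le_trans _ _ (d * d.-1)%:R%R).
  rewrite ler_nat (leq_trans (size_queries_le _ _ _ _ _)) // size_allpairs !size_iota.
  move: ne; rewrite negb_and => /orP[] ne; last by apply: leq_mul => //; lia.
  by rewrite mulnC; apply: leq_mul => //; lia.
case: d d1 {ad bd ne} => // d d1 /=.
have dR : (1 <= d%:R :> R)%R by rewrite ler1n.
have dR1 : (d.+1%:R = d%:R + 1 :> R)%R by rewrite -natr1.
by rewrite /growth natrM dR1; nra.
Qed.

(** * Rooted trees and their embeddings *)

Section Tree.
Variable T : rooted_tree.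
Implicit Types (u v w p c : 'I_(nv T)) (s : seq 'I_(nv T)).

Lemma child_root p : child p (root T) = false.
Proof. by apply/negbTE/root_no_parent. Qed.

Lemma child_inj p q c : child p c -> child q c -> p = q.
Proof. exact: parent_unique. Qed.

Lemma connect_root v : connect (@child T) (root T) v.
Proof. by have := root_connect v; rewrite (eq_connect (e' := @child T)). Qed.

(** If the last vertex had occurred before, its two predecessors would coincide by uniqueness of
    parents, an earlier repetition. *)
Lemma path_uniq s : path (@child T) (root T) s -> uniq (root T :: s).
Proof.
elim/last_ind: s => // s x IH; rewrite rcons_path => /andP[ps lx].
rewrite -rcons_cons rcons_uniq IH // andbT inE negb_or.
have -> /= : x != root T by apply: contraTneq lx => ->; rewrite child_root.
apply/negP => xs; move: ps lx (IH ps); case/splitPr: xs => s1 s2.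
rewrite cat_path last_cat -cat_cons cat_uniq.
move=> /and3P[_ lx _] lx' /and3P[_ /hasPn h _].
by have := h _ (mem_last x s2); have /= -> := child_inj lx' lx; rewrite mem_last.
Qed.

Lemma acyclic u c : child u c -> ~~ connect (@child T) c u.
Proof.
move=> uc; apply/negP => /connectP[s2 ps2 lu].
have /connectP[s1 ps1 lu1] := connect_root u.
have : path (@child T) (root T) (s1 ++ c :: s2) by rewrite cat_path ps1 -lu1 /= uc.
move/path_uniq; rewrite -cat_cons cat_uniq => /and3P[_ /hasPn h _].
by have := h _ (mem_last c s2); rewrite -lu lu1 mem_last.
Qed.

Lemma connect_child_last c w :
  connect (@child T) c w -> w = c \/ exists2 p, connect (@child T) c p & child p w.
Proof.
case/connectP=> s; case/lastP: s => [|s x]; first by left.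
rewrite rcons_path last_rcons => /andP[ps lx] ->; right.
by exists (last c s) => //; apply/connectP; exists s.
Qed.

(** Climb from [w] along both paths at once: parents are unique, so one of [c] and [c'] lies below
    the other, and if they differed there would be a cycle through [u]. *)
Lemma siblings_disjoint u c c' w : child u c -> child u c' ->
  connect (@child T) c w -> connect (@child T) c' w -> c = c'.
Proof.
move=> uc uc' /connectP[s]; elim/last_ind: s w => [|s x IH] w.
  move=> _ -> /connect_child_last[// |[p c'p /(child_inj uc) E]].
  by have := acyclic uc'; rewrite E c'p.
rewrite rcons_path last_rcons => /andP[ps lx] ->.
case/connect_child_last => [E|[p c'p px]].
  rewrite E in lx; have := acyclic uc.
  by rewrite (child_inj uc' lx); case/negP; apply/connectP; exists s.
by apply: (IH (last c s)) => //; rewrite (child_inj lx px).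
Qed.

Definition below u : pred 'I_(nv T) := connect (@child T) u.

(** The subtrees below the children are disjoint and miss [u], which accounts for the successor. *)
Lemma card_below u : (\sum_(c <- children u) #|below c|).+1 <= #|below u|.
Proof.
have -> : \sum_(c <- children u) #|below c| =
    \sum_(w : 'I_(nv T)) count (fun c => below c w) (children u).
  under eq_bigr => c _ do rewrite -sum1_card big_mkcond.
  by rewrite exchange_big; apply: eq_bigr => w _; rewrite -sum1_count [RHS]big_mkcond.
rewrite -[leqRHS]sum1_card [X in _ < X](bigD1 u) ?inE ?/below ?unfold_in ?connect0 //=.
rewrite ltnS big_mkcond /=.
rewrite [leqRHS]big_mkcond; apply: leq_sum => w _.
case: (boolP (has (fun c => below c w) (children u))) => [/hasP[c cu cw]|]; last first.
  by rewrite has_count -eqn0Ngt => /eqP->.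
have -> : (w \in below u) && (w != u).
  apply/andP; split; first exact: connect_trans (connect1 cu) cw.
  by apply: contraTneq cw => ->; apply: acyclic.
rewrite -(@eq_in_count _ (pred1 c)) ?count_uniq_mem ?children_uniq ?leq_b1 //.
move=> c' /= c'u; apply/eqP/idP => [->// |c'w].
exact: siblings_disjoint c'u cu c'w cw.
Qed.

Fixpoint shallow (k : nat) u : bool :=
  if k is k'.+1 then all (shallow k') (children u) else false.

Lemma shallow_paths k u :
  (forall s, path (@child T) u s -> size s < k) -> shallow k u.
Proof.
elim: k u => [|k IH] u h /=; first by have := h [::] isT.
apply/allP => c uc; apply: IH => s ps.
by rewrite -ltnS; apply: (h (c :: s)); rewrite /= ps andbT.
Qed.

Lemma size_path_root s : path (@child T) (root T) s -> size s < nv T.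
Proof.
move=> /path_uniq/card_uniqP E.
by rewrite -[_.+1]/(size (root T :: s)) -E -[leqRHS]card_ord max_card.
Qed.

Lemma shallow_nv : shallow (nv T) (root T).
Proof. exact/shallow_paths/size_path_root. Qed.

(** [height_le] speaks only of paths ending in a leaf. Any other path can be prolonged, and this
    stops because paths from the root do not repeat vertices. *)
Lemma shallow_height h : height_le h T -> shallow h.+1 (root T).
Proof.
move=> hT; apply: shallow_paths => s; rewrite ltnS.
have [n] := ubnP (nv T - size s); elim: n s => // n IH s /ltnSE le ps.
case E : (children (last (root T) s)) => [|c cs]; first exact: hT.
apply: (@leq_trans (size (rcons s c))); first by rewrite size_rcons.
have ps' : path (@child T) (root T) (rcons s c).
  by rewrite rcons_path ps /child E mem_head.
by apply: IH ps'; rewrite size_rcons; have := size_path_root ps; lia.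
Qed.

End Tree.

Section Embedding.
Variables H G : rooted_tree.

(** Injectivity is required only among siblings, so that the condition splits over the subtrees of
    the children; [emb_root] recovers it globally. *)
Definition embeds_by (u : 'I_(nv H)) (v : 'I_(nv G)) (f : 'I_(nv H) -> 'I_(nv G)) :=
  f u = v /\ forall p, below u p ->
    {in children p &, injective f} /\ {in children p, forall c, child (f p) (f c)}.

Definition emb (u : 'I_(nv H)) (v : 'I_(nv G)) : bool := `[< exists f, embeds_by u v f >].

Definition kidH (u : 'I_(nv H)) i := nth (root H) (children u) i.
Definition kidG (v : 'I_(nv G)) j := nth (root G) (children v) j.

Lemma embE u v : emb u v =
  matchable (size (children u)) (size (children v))
    (fun i j => emb (kidH u i) (kidG v j)).
Proof.
apply/asboolP/matchableP => [[f [fu fP]]|[g gi gM]].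
  have [fi fc] := fP u (connect0 _ _); rewrite fu in fc.
  have idx (i : 'I_(size (children u))) :
      index (f (kidH u i)) (children v) < size (children v).
    by rewrite index_mem; apply/fc/mem_nth.
  exists (fun i => Ordinal (idx i)) => [i j [] E|i].
    have : f (kidH u i) = f (kidH u j).
      have fk k : k < size (children u) -> f (kidH u k) \in children v.
        by move=> ku; apply/fc/mem_nth.
      by rewrite -(nth_index (root G) (fk i _)) // E nth_index ?fk.
    move/fi; rewrite !mem_nth // => /(_ isT isT)/eqP.
    by rewrite nth_uniq ?children_uniq // => /eqP/ord_inj.
  apply/asboolP; exists f; split=> [|p ip].
    by rewrite /= /kidG nth_index //; apply/fc/mem_nth.
  by apply: fP; apply: connect_trans ip; apply/connect1/mem_nth.
have ex_F (i : 'I_(size (children u))) :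
    exists F, embeds_by (kidH u i) (kidG v (g i)) F by apply/asboolP/gM.
have [F FP] := boolp.choice ex_F.
have uk (i : 'I_(size (children u))) : child u (kidH u i) by apply: mem_nth.
(* Glues the embeddings of the disjoint subtrees. The default [v] is the value at [u], which lies
   below none of its children. *)
pose f w := if [pick i : 'I_(size (children u)) | below (kidH u i) w] is Some i
            then F i w else v.
have fu : f u = v.
  rewrite /f; case: pickP => // i; rewrite /below => h.
  by have := acyclic (uk i); rewrite h.
have fF (i : 'I_(size (children u))) w : below (kidH u i) w -> f w = F i w.
  move=> iw; rewrite /f; case: pickP => [j jw|/(_ i)]; last by rewrite iw.
  have := siblings_disjoint (uk i) (uk j) iw jw => /eqP.
  by rewrite nth_uniq ?children_uniq // => /eqP/ord_inj->.
have fk (i : 'I_(size (children u))) : f (kidH u i) = kidG v (g i).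
  by rewrite (fF i) ?/below ?connect0 // (FP i).1.
have kidP c : child u c -> exists i : 'I_(size (children u)), c = kidH u i.
  move=> uc; have lt : index c (children u) < size (children u) by rewrite index_mem.
  by exists (Ordinal lt); rewrite /kidH nth_index.
exists f; split=> // p /connectP[[|c s] /= ps ->].
  rewrite fu; split=> [x y /kidP[i ->] /kidP[j ->]|x /kidP[i ->]];
    rewrite !fk; last exact: mem_nth.
  move/eqP; rewrite nth_uniq ?children_uniq // => /eqP/ord_inj/gi->//.
case/andP: ps => /kidP[i ->] ps.
have ip : below (kidH u i) (last (kidH u i) s) by apply/connectP; exists s.
set p' := last _ s in ip *.
have ic x : x \in children p' -> below (kidH u i) x.
  by move=> px; apply: connect_trans ip (connect1 px).
have [iF cF] := (FP i).2 _ ip.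
split=> [x y px py|x px]; rewrite !(fF i) ?ip ?ic //; first exact: iF.
exact: cF.
Qed.

Lemma emb_root : subtree_iso H G <-> emb (root H) (root G).
Proof.
split=> [[f [fi fr fc]]|/asboolP[f [fr fP]]].
  apply/asboolP; exists f; split=> // p _; split=> [x y _ _ /fi // |c]; exact: fc.
have {}fP p := fP p (connect_root p).
exists f; split=> // [x y|p c]; last by case: (fP p) => _; apply.
(* Injectivity by induction along the path to [x]: equal images have equal parents in [G], so by
   induction the parents in [H] agree and injectivity among siblings applies. *)
have /connectP[s] := connect_root x; elim/last_ind: s x y => [|s x' IH] x y.
  move=> _ ->; have [// |[q _ qy] E] := connect_child_last (connect_root y).
  by have := (fP q).2 _ qy; rewrite -E fr child_root.
rewrite rcons_path last_rcons => /andP[ps lx] -> E.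
have [E'|[q _ qy]] := connect_child_last (connect_root y).
  by have := (fP _).2 _ lx; rewrite E E' fr child_root.
have fx := (fP _).2 _ lx; have := (fP _).2 _ qy; rewrite -E => /(child_inj fx).
move/(IH _ _ ps erefl) => lq; rewrite -lq in qy.
exact: (fP (last (root H) s)).1.
Qed.

End Embedding.

(** * Runs of the machine *)

Section Safe.
Variables (R : realType) (P : program) (A : Prop).
Local Open Scope ring_scope.

(** Bounding all partial sums keeps the calculus in [R], away from convergence questions. *)
Definition time_le (c : config) (y : R) :=
  forall K, \sum_(0 <= k < K) prob_running R P k c <= y.

(* Both properties propagate backwards along the steps of the machine, so a
   procedure call is specified by what is safe after its return. *)
Definition safe (c : config) (y : R) := always_answers P c A /\ time_le c y.

Lemma safe_ge0 c y : safe c y -> 0 <= y.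
Proof. by case=> _ /(_ 0%N); rewrite big_nil. Qed.

Lemma safe_step c (n : nat) (f : nat -> R) (g : nat -> config) y :
  step P c = [seq g i | i <- iota 0 n.+1] ->
  (forall i, (i < n.+1)%N -> safe (g i) (f i)) ->
  1 + (\sum_(i < n.+1) f i) / n.+1%:R <= y -> safe c y.
Proof.
move=> sc sg le_y; have n0 : 0 < n.+1%:R^-1 :> R by rewrite invr_gt0 ltr0n.
have pg : 0 <= (\sum_(i < n.+1) f i) / n.+1%:R.
  by apply: mulr_ge0 (ltW n0); apply: sumr_ge0 => i _; apply: safe_ge0 (sg i _).
split=> [|[|K]].
- case=> [|k] c' b /=.
    by move=> -> cb; move: sc; rewrite /step cb.
  rewrite sc size_map size_iota => -[i [ltn]].
  by rewrite (nth_map 0%N) ?size_iota // nth_iota // add0n; apply: (sg i ltn).1.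
- by rewrite big_nil; apply: le_trans le_y; rewrite addr_ge0.
apply: le_trans le_y; rewrite big_nat_recl //= lerD //.
  by rewrite sc size_map size_iota.
rewrite sc size_map size_iota -mulr_suml ler_pM2r // big_mkord.
under [leLHS]eq_bigr => k _ do
  rewrite big_map -[iota 0 n.+1]/(index_iota 0 n.+1) big_mkord.
rewrite exchange_big.
apply: ler_sum => i _.
by have [_ /(_ K)] := sg i (ltn_ord i); rewrite big_mkord.
Qed.

Lemma safe_det c c' y : step P c = [:: c'] -> safe c' (y - 1) -> safe c y.
Proof.
move=> sc sc'; apply: (@safe_step c 0 (fun=> y - 1) (fun=> c')) => //.
by rewrite big_ord1 divr1 addrC subrK.
Qed.

Lemma safe_halt c b y :
  cur_instr P c = Halt b -> (b = true <-> A) -> 0 <= y -> safe c y.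
Proof.
move=> cb bA y0; have sc : step P c = [::] by rewrite /step cb.
split=> [[|k] c' b' /=|K]; first by move=> ->; rewrite cb => -[<-].
  by rewrite sc => -[i []].
rewrite big1 // => -[|k] _ /=; first by rewrite sc.
by rewrite sc big_nil mul0r.
Qed.

Lemma expected_time_le c y : safe c y -> (expected_time R P c <= y%:E)%E.
Proof.
case=> _ tc; have ge0 k c' : 0 <= prob_running R P k c'.
  elim: k c' => [|k IH] c'; first exact: ler0n.
  rewrite /=.
  by rewrite divr_ge0 ?ler0n // sumr_ge0.
apply: lime_le; first by apply: is_cvg_nneseries => k _; rewrite lee_fin.
by apply: nearW => K; rewrite sumEFin lee_fin.
Qed.

End Safe.

(* The program is a sequence of blocks of equal size, one for each label.  A
   label carries the finite information that the program keeps in its program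
   counter: [DegG a] is reached once [a] children of [u] have been counted,
   [Pick a b] draws an order of the queries at random, and [Test a b todo kn] is
   a state of the resulting decision procedure. *)
Inductive label :=
  | Start
  | Entry
  | DegG of nat
  | Pick of nat & nat
  | Test of nat & nat & seq (nat * nat) & seq (nat * nat * bool).

HB.instance Definition _ := gen_eqMixin label.

(** The full decision tree, including nodes that early stopping never reaches, so that both answers
    always lead to a label. *)
Fixpoint tests (a b : nat) (todo : seq (nat * nat)) kn : seq label :=
  Test a b todo kn ::
  if todo is q :: todo' then
    tests a b todo' ((q, true) :: kn) ++ tests a b todo' ((q, false) :: kn)
  else [::].

Lemma head_tests a b todo kn : Test a b todo kn \in tests a b todo kn.
Proof. by case: todo => *; rewrite mem_head. Qed.

(** * The program text and the execution of its blocks *)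

Section Code.
Variable d : nat.

Definition labels : seq label :=
  Start :: Entry :: [seq DegG a | a <- iota 0 d.+1] ++
  [seq Pick a b | a <- iota 0 d.+1, b <- iota 0 d.+1] ++
  flatten [seq flatten [seq tests ab.1 ab.2 o [::] | o <- orders d ab.1 ab.2]
          | ab <- [seq (a, b) | a <- iota 0 d.+1, b <- iota 0 d.+1]].

Lemma DegG_labels a : a <= d -> DegG a \in labels.
Proof.
by move=> ad; rewrite 2!in_cons mem_cat map_f ?mem_iota ?orbT.
Qed.

Lemma Pick_labels a b : a <= d -> b <= d -> Pick a b \in labels.
Proof.
move=> ad bd; rewrite 2!in_cons 2!mem_cat.
do 3![apply/orP; right]; apply/orP; left.
by apply: allpairs_f; rewrite mem_iota.
Qed.

Lemma tests_labels a b o : a <= d -> b <= d -> o \in orders d a b ->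
  {subset tests a b o [::] <= labels}.
Proof.
move=> ad bd oo l lo; rewrite 2!in_cons 2!mem_cat.
do 4![apply/orP; right]; apply/flatten_mapP; exists (a, b).
  by apply: allpairs_f; rewrite mem_iota.
by apply/flatten_mapP; exists o.
Qed.

Definition block_size : nat := 20 + 4 * d.

Definition addr (l : label) : nat := block_size * index l labels.

(* The instruction [i] puts a number into register 3, which then selects an
   entry of the jump table. *)
Definition switch (l : label) (i : instr) (targets : seq label) : program :=
  [:: i; AddC 3 3 (addr l + 3); JumpR 3] ++ [seq Jump (addr t) | t <- targets].

(* Registers 0 and 1 hold the addresses of [u] and [v], register 2 the stack
   pointer; the two jumps for the answers of the call start at offset 12. *)
Definition call (l : label) (q : nat * nat) : program :=
  [:: Write 2 0; AddC 2 2 1; Write 2 1; AddC 2 2 1;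
      Const 3 (addr l + 12); Write 2 3; AddC 2 2 1;
      AddC 0 0 q.1.+1; Read 0 0; AddC 1 1 q.2.+1; Read 1 1].

Definition ret (e : bool) : program :=
  [:: SubC 2 2 1; Read 3 2; SubC 2 2 1; Read 1 2; SubC 2 2 1; Read 0 2;
      AddC 3 3 (~~ e); JumpR 3].

(** [Start] fakes a frame: two arbitrary cells, then a return address at which the answers yes and
    no meet [Halt true] and [Halt false]. *)
Definition code (l : label) : program :=
  match l with
  | Start => [:: AddC 2 2 2; Const 3 (addr Start + 5); Write 2 3; AddC 2 2 1;
                 Jump (addr Entry); Halt true; Halt false]
  | Entry => switch l (Read 3 0) [seq DegG a | a <- iota 0 d.+1]
  | DegG a => switch l (Read 3 1) [seq Pick a b | b <- iota 0 d.+1]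
  | Pick a b => switch l (Rand 3 (size (orders d a b)).-1)
                  [seq Test a b o [::] | o <- orders d a b]
  | Test a b todo kn =>
      if matchable a b (lo kn) then ret true
      else if ~~ matchable a b (hi kn) then ret false
      else if todo is q :: todo' then
        call l q ++ [:: Jump (addr Entry);
                        Jump (addr (Test a b todo' ((q, true) :: kn)));
                        Jump (addr (Test a b todo' ((q, false) :: kn)))]
      else [::]
  end.

Definition prog : program :=
  mkseq (fun i => nth (Halt false) (code (nth Start labels (i %/ block_size)))
                      (i %% block_size))
        (block_size * size labels).

Lemma fetch l o r m : l \in labels -> o < block_size ->
  cur_instr prog (Config (addr l + o) r m) = nth (Halt false) (code l) o.
Proof.
move=> ll ob; have b0 : 0 < block_size by [].
rewrite /cur_instr /= nth_mkseq.
  by rewrite /addr mulnC divnMDl // modnMDl divn_small // addn0 modn_small // nth_index.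
rewrite -index_mem in ll; apply: (@leq_trans (addr l + block_size)).
  by rewrite ltn_add2l.
by rewrite /addr -mulnSr leq_mul2l ll orbT.
Qed.

(** Symbolic execution of the deterministic instructions that fall through; [safe_straight] then
    treats a whole stretch of them by computation. *)
Definition effect (i : instr) (s : (nat -> nat) * (nat -> nat)) :=
  match i with
  | Const r k => Some (upd s.1 r k, s.2)
  | AddC r t k => Some (upd s.1 r (s.1 t + k), s.2)
  | SubC r t k => Some (upd s.1 r (s.1 t - k), s.2)
  | Read r t => Some (upd s.1 r (s.2 (s.1 t)), s.2)
  | Write r t => Some (s.1, upd s.2 (s.1 r) (s.1 t))
  | _ => None
  end.

Fixpoint straight (is_ : seq instr) (s : (nat -> nat) * (nat -> nat)) :=
  if is_ is i :: is' then obind (straight is') (effect i s) else Some s.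

Section Run.
Variables (R : realType) (A : Prop).
Notation safe := (@safe R prog A).
Local Open Scope ring_scope.

Lemma safe_jump l (o : nat) t r m (y : R) : l \in labels -> (o < block_size)%N ->
  nth (Halt false) (code l) o = Jump t ->
  safe (Config t r m) (y - 1) -> safe (Config (addr l + o) r m) y.
Proof.
by move=> ll ob E; apply: safe_det; rewrite /step fetch // E.
Qed.

Lemma safe_jumpR l (o : nat) t r m (y : R) : l \in labels -> (o < block_size)%N ->
  nth (Halt false) (code l) o = JumpR t ->
  safe (Config (r t) r m) (y - 1) -> safe (Config (addr l + o) r m) y.
Proof.
by move=> ll ob E; apply: safe_det; rewrite /step fetch // E.
Qed.

Lemma safe_straight l (o : nat) is_ r m r' m' (y : R) : l \in labels ->
  (o + size is_ <= block_size)%N ->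
  take (size is_) (drop o (code l)) = is_ ->
  straight is_ (r, m) = Some (r', m') ->
  safe (Config (addr l + (o + size is_)) r' m') (y - (size is_)%:R) ->
  safe (Config (addr l + o) r m) y.
Proof.
elim: is_ o r m y => [|i is_ IH] o r m y ll; first by rewrite addn0 subr0 => _ _ [-> ->].
rewrite /= addnS => ob; case D: (drop o (code l)) => [|i' s] //= [ii Ds].
have oc : (o < size (code l))%N.
  by rewrite ltnNge; apply/negP => /drop_oversize; rewrite D.
move: D; rewrite (drop_nth (Halt false)) // => -[Di D].
rewrite -natr1 opprD addrA addrAC => st sf.
have {}ii : nth (Halt false) (code l) o = i by rewrite Di.
have ob' : (o < block_size)%N by lia.
case Ei : (effect i (r, m)) st => [[r1 m1]|] //= st.
apply: (@safe_det _ _ _ _ (Config (addr l + o.+1) r1 m1)).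
  rewrite /step fetch // ii.
  by case: i Ei {ii} => //= *;
    match goal with H : Some _ = _ |- _ => case: H => <- <- end; rewrite ?addnS.
by apply: (IH _ _ _ _ ll) st _ => //; rewrite ?D // addSn ?addnS // in sf *.
Qed.

(** Starts at offset 1, after [i] has filled register 3. The cost 3 is the addition, the indirect
    jump and the jump in the table. *)
Lemma safe_switch l i ts r m k (y : R) : l \in labels ->
  code l = switch l i ts -> (size ts <= 4 * d + 1)%N -> r 3 = k -> (k < size ts)%N ->
  (forall r', (forall x, (x < 3)%N -> r' x = r x) ->
     safe (Config (addr (nth Start ts k)) r' m) (y - 3)) ->
  safe (Config (addr l + 1) r m) y.
Proof.
move=> ll cl sts r3 ks h.
apply: (safe_straight (is_ := [:: AddC 3 3 (addr l + 3)])) => //; rewrite ?cl //=.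
apply: safe_jumpR => //; rewrite ?cl //= {2}/upd /= r3.
have -> : (k + (addr l + 3) = addr l + (3 + k))%N by lia.
apply: safe_jump => //; rewrite ?cl /block_size; first lia.
  by rewrite -[(3 + k)%N]/k.+3 /= (nth_map Start).
have -> : y - 1 - 1 - 1 = y - 3 by lra.
by apply: h => x x3; rewrite /upd; case: eqP => // E; rewrite E in x3.
Qed.

End Run.
End Code.

(** * Correctness and cost of a call *)

Section Eval.
Variables (R : realType) (d : nat) (H G : rooted_tree).
Hypotheses (d_gt0 : 0 < d) (hH : max_children d H) (hG : max_children d G).
Variables (m0 : nat -> nat) (free : nat).
Variables (locH : 'I_(nv H) -> nat) (locG : 'I_(nv G) -> nat).
Hypotheses (sH : @stored m0 free H locH) (sG : @stored m0 free G locG).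
Variable A : Prop.
Notation safe := (@safe R (prog d) A).
Notation addr := (addr d).
Notation labels := (labels d).

(* A frame occupies [s], [s+1], [s+2]: the caller's registers 0 and 1, then the
   address to return to on the answer yes; the next one is for the answer no. *)
Definition ready (r m : nat -> nat) (s : nat) (u : 'I_(nv H)) (v : 'I_(nv G)) :=
  [/\ free <= s, forall x, x < free -> m x = m0 x,
      r 0 = locH u, r 1 = locG v & r 2 = s + 3].

(** The continuation of a call: it may rely on the restored registers and on the memory below the
    frame, and on nothing else. *)
Definition returns (m : nat -> nat) (s : nat) (e : bool) (y : R) :=
  forall r' m', r' 0 = m s -> r' 1 = m (s + 1) -> r' 2 = s ->
    (forall x, x < s -> m' x = m x) ->
    safe (Config (m (s + 2) + ~~ e) r' m') y.

Lemma safe_ret l e r m s (y : R) : l \in labels -> code d l = ret e ->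
  r 2 = s + 3 -> returns m s e y -> safe (Config (addr l + 0) r m) (8 + y)%R.
Proof.
move=> ll cl r2 h.
apply: (safe_straight (is_ := take 7 (ret e)) ll); [by []|by rewrite cl|by []|].
apply: (safe_jumpR (t := 3) ll); [by []|by rewrite cl|rewrite /=].
have -> : (8 + y - 7%:R - 1 = y)%R by lra.
rewrite /upd /= r2.
have -> : s + 3 - 1 = s + 2 by lia.
have -> : s + 2 - 1 = s + 1 by lia.
have -> : s + 1 - 1 = s by lia.
by apply: h.
Qed.

Definition kids (u : 'I_(nv H)) (v : 'I_(nv G)) (i j : nat) : bool :=
  emb (kidH u i) (kidG v j).
Definition degH (u : 'I_(nv H)) := size (children u).
Definition degG (v : 'I_(nv G)) := size (children v).

Lemma lo_hi (u : 'I_(nv H)) (v : 'I_(nv G)) kn :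
  {in kn, forall x, x.2 = kids u v x.1.1 x.1.2} ->
  decided (degH u) (degG v) kn ->
  matchable (degH u) (degG v) (lo kn) = emb u v.
Proof.
move=> knP dec; rewrite embE -/(degH u) -/(degG v).
apply/idP/idP => [|h].
  by apply: sub_matchable => i j _ _ /knP /=; rewrite /kids => <-.
case/orP: dec => // /negP[]; apply: sub_matchable h => i j _ _ k.
by apply/negP => /knP /=; rewrite /kids k.
Qed.

Lemma all_known_decided (u : 'I_(nv H)) (v : 'I_(nv G)) kn :
  {in kn, forall x, x.2 = kids u v x.1.1 x.1.2} ->
  (forall i j, i < degH u -> j < degG v -> ((i, j), kids u v i j) \in kn) ->
  decided (degH u) (degG v) kn.
Proof.
move=> knP all; rewrite /decided.
rewrite (@eq_matchable _ _ (lo kn) (hi kn)) ?orbN // => i j ia jb.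
have := all i j ia jb; rewrite /lo /hi; case E: (kids u v i j) => k; rewrite k.
  by apply/esym/negP => /knP; rewrite /= E.
by apply/negP => /knP; rewrite /= E.
Qed.

(* [W k u v] is any function satisfying the recursive inequality [W_ge] for the
   expected time at [(u, v)]; [k] exceeds the height of [u]. *)
Variable W : nat -> 'I_(nv H) -> 'I_(nv G) -> R.

(** The 13 steps are the eleven instructions of [call], the jump to [Entry] and the jump after the
    return. *)
Definition kid_cost k (u : 'I_(nv H)) (v : 'I_(nv G)) (q : nat * nat) : R :=
  (13 + W k (kidH u q.1) (kidG v q.2))%R.

Definition evaluates k (u : 'I_(nv H)) (v : 'I_(nv G)) := forall r m s (y : R),
  ready r m s u v -> returns m s (emb u v) y ->
  safe (Config (addr Entry) r m) (W k u v + y)%R.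

Lemma safe_test k u v todo kn r m s (y : R) :
  (forall q, q.1 < degH u -> q.2 < degG v -> evaluates k (kidH u q.1) (kidG v q.2)) ->
  {subset tests (degH u) (degG v) todo kn <= labels} ->
  {in kn, forall x, x.2 = kids u v x.1.1 x.1.2} ->
  {in todo, forall q, q.1 < degH u /\ q.2 < degG v} ->
  (forall i j, i < degH u -> j < degG v ->
     (i, j) \in todo \/ ((i, j), kids u v i j) \in kn) ->
  ready r m s u v -> returns m s (emb u v) y ->
  safe (Config (addr (Test (degH u) (degG v) todo kn)) r m)
    (\sum_(q <- queries (degH u) (degG v) (kids u v) todo kn) kid_cost k u v q
       + (8 + y))%R.
Proof.
move=> IH; elim: todo kn r m s y => [|q todo IHt] kn r m s y sub knP tdP all rd rt.
  have dec : decided (degH u) (degG v) kn.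
    by apply: all_known_decided => // i j ia jb; case: (all i j ia jb).
  rewrite /= dec big_nil add0r -[addr _]addn0.
  apply: safe_ret (rt); [exact/sub/head_tests|rewrite /=|by case: rd].
  rewrite -(lo_hi knP dec); case: ifP => // lo0.
  by move: dec; rewrite /decided lo0 /= => ->.
set l := Test _ _ _ _; have ll : l \in labels by exact/sub/head_tests.
rewrite /=; case dec : (decided _ _ _).
  rewrite big_nil add0r -[addr _]addn0.
  apply: safe_ret (rt); [by []|rewrite /=|by case: rd].
  rewrite -(lo_hi knP dec); case: ifP => // lo0.
  by move: dec; rewrite /decided lo0 /= => ->.
have cl : code d l = call d l q ++ [:: Jump (addr Entry);
    Jump (addr (Test (degH u) (degG v) todo ((q, true) :: kn)));
    Jump (addr (Test (degH u) (degG v) todo ((q, false) :: kn)))].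
  by move/negbT: dec; rewrite /decided negb_or negbK /= => /andP[/negPf-> ->].
have [qa qb] := tdP q (mem_head _ _); have [fs mm r0 r1 r2] := rd.
rewrite big_cons -[addr l]addn0.
apply: (safe_straight (is_ := call d l q) ll); [by []|by rewrite cl|by []|].
apply: (safe_jump (t := addr Entry) ll); [by []|by rewrite cl|rewrite /=].
have [lH mH kH] := sH u; have [lG mG kG] := sG v.
set m' := upd (upd (upd m _ _) _ _) _ _; set r' := upd _ _ _.
rewrite /kid_cost; set Wq := W _ _ _; set Sq := (\sum_(_ <- _) _)%R.
have -> : (13 + Wq + Sq + (8 + y) - 11%:R - 1 = Wq + (1 + (Sq + (8 + y))))%R by lra.
(* The new frame starts at [s + 3], so the input and the current frame survive. *)
have m'E x : x < s + 3 -> m' x = m x.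
  by move=> xs; rewrite /m' /upd r2; do !case: eqP => //=; lia.
have m'0 x : x < free -> m' x = m0 x.
  by move=> xf; rewrite m'E ?mm //; lia.
have m'3 : m' (s + 3) = r 0.
  by rewrite /m' /upd /= r2; do !case: eqP => //=; lia.
have m'4 : m' (s + 3 + 1) = r 1.
  by rewrite /m' /upd /= r2; do !case: eqP => //=; lia.
have m'5 : m' (s + 3 + 2) = addr l + 12.
  by rewrite /m' /upd /= r2; do !case: eqP => //=; lia.
have r'0 : r' 0 = m' (r 0 + q.1.+1) by [].
have r'1 : r' 1 = m' (r 1 + q.2.+1) by [].
have r'2 : r' 2 = s + 3 + 3 by rewrite -addnA; rewrite /r' /upd /= r2; lia.
apply: (IH q qa qb _ _ (s + 3)).
  split=> //; first lia.
  - by rewrite r'0 r0 m'0 ?kH //; rewrite /degH in qa; lia.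
  - by rewrite r'1 r1 m'0 ?kG //; rewrite /degG in qb; lia.
move=> r'' m'' r''0 r''1 r''2 m''E; rewrite m'5 -addnA.
rewrite m'3 in r''0; rewrite m'4 in r''1.
have {}m''E x : x < s + 3 -> m'' x = m x by move=> xs; rewrite m''E ?m'E.
(* The return offset [12 + ~~ e] selects the branch labelled with the true answer. *)
apply: (safe_jump
  (t := addr (Test (degH u) (degG v) todo ((q, kids u v q.1 q.2) :: kn))) ll).
- by case: emb.
- by rewrite cl /kids; case: emb.
rewrite addrC addKr.
apply: (IHt _ _ _ s).
- move=> x xt; apply: sub; rewrite /= inE mem_cat; apply/orP; right.
  by case: (kids u v q.1 q.2) xt => ->; rewrite ?orbT.
- by move=> x; rewrite inE => /orP[/eqP-> //|/knP].
- by move=> x xt; apply: tdP; rewrite inE xt orbT.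
- move=> i j ia jb; case: (all i j ia jb) => [|ijk]; last by right; rewrite inE ijk orbT.
  by rewrite inE => /orP[/eqP <-|]; [right; rewrite mem_head|left].
- split=> //; rewrite ?r''0 ?r''1 //.
  by move=> x xf; rewrite m''E ?mm //; lia.
move=> r3 m3; rewrite !m''E; try lia.
move=> h0 h1 h2 h3; apply: rt => // x xs.
by rewrite h3 // m''E //; lia.
Qed.

(** The 20 steps are four each for the blocks [Entry], [DegG] and [Pick], and eight for [ret]. *)
Hypothesis W_ge : forall k u v, shallow k.+1 u ->
  (20 + (\sum_(o <- orders d (degH u) (degG v))
          \sum_(q <- queries (degH u) (degG v) (kids u v) o [::]) kid_cost k u v q)
        / (size (orders d (degH u) (degG v)))%:R <= W k.+1 u v)%R.

Lemma safe_entry k u v : shallow k u -> evaluates k u v.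
Proof.
elim: k u v => // k IH u v shu r m s y rd rt.
have [fs mm r0 r1 r2] := rd; have [lH mH _] := sH u; have [lG mG _] := sG v.
have [au bv] : degH u <= d /\ degG v <= d by split; [exact: hH|exact: hG].
have d0 : Entry \in labels by rewrite 2!in_cons eqxx orbT.
rewrite -[addr Entry]addn0.
apply: (safe_straight (is_ := [:: Read 3 0]) d0); [by []|by []|by []|].
apply: (safe_switch d0 (ts := [seq DegG a | a <- iota 0 d.+1]) (k := degH u)).
- by [].
- by rewrite size_map size_iota; lia.
- by rewrite /upd /= r0 mm //; lia.
- by rewrite size_map size_iota ltnS.
move=> ra raE.
have {}raE x : x < 3 -> ra x = r x by move=> x3; rewrite raE // /upd /= ltn_eqF.
rewrite (nth_map 0) ?size_iota ?nth_iota ?add0n //.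
have d1 := DegG_labels au.
rewrite -[addr (DegG _)]addn0.
apply: (safe_straight (is_ := [:: Read 3 1]) d1); [by []|by []|by []|].
apply: (safe_switch d1 (ts := [seq Pick (degH u) b | b <- iota 0 d.+1]) (k := degG v)).
- by [].
- by rewrite size_map size_iota; lia.
- by rewrite /upd /= raE // r1 mm //; lia.
- by rewrite size_map size_iota ltnS.
move=> rb rbE.
have {}rbE x : x < 3 -> rb x = r x by move=> x3; rewrite rbE // /upd /= ltn_eqF // raE.
rewrite (nth_map 0) ?size_iota ?nth_iota ?add0n //.
have d2 := Pick_labels au bv.
set os := orders d (degH u) (degG v).
have so : 0 < size os by rewrite /os size_orders; case: ifP => // _; lia.
pose F i := (\sum_(q <- queries (degH u) (degG v) (kids u v) (nth [::] os i) [::])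
              kid_cost k u v q + (8 + y) + 3)%R.
rewrite -[addr (Pick _ _)]addn0.
apply: (@safe_step _ _ _ _ (size os).-1 F
   (fun i => set_reg (Config (addr (Pick (degH u) (degG v)) + 0) rb m) 3 i)).
- by rewrite /step fetch.
- move=> i; rewrite prednK // => ios; rewrite /set_reg /= -addnS.
  apply: (safe_switch d2 (ts := [seq Test (degH u) (degG v) o [::] | o <- os]) (k := i)).
  + by [].
  + by rewrite size_map size_orders; case: ifP => _; lia.
  + by [].
  + by rewrite size_map.
  move=> rc rcE; rewrite (nth_map [::]) // /F addrK.
  have oos : nth [::] os i \in os by rewrite mem_nth.
  have [_ mo] := orders_pairs oos.
  apply: (safe_test (s := s)) => //.
  + move=> q qa qb; apply: IH; move: shu => /= /allP; apply; exact: mem_nth.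
  + exact: tests_labels.
  + by move=> [a b]; rewrite mo => /andP.
  + by move=> a b ia jb; left; rewrite mo ia jb.
  + have rcr x : x < 3 -> rc x = r x.
      by move=> x3; rewrite rcE // /upd /= ltn_eqF // rbE.
    by split=> //; rewrite rcr.
have := W_ge v shu; rewrite -/os prednK // => hW.
have son : ((size os)%:R != 0 :> R)%R by rewrite pnatr_eq0 -lt0n.
have -> : (\sum_(i < size os) F i = (8 + y + 3) * (size os)%:R + \sum_(o <- os)
    \sum_(q <- queries (degH u) (degG v) (kids u v) o [::]) kid_cost k u v q)%R.
  rewrite (big_nth [::]) big_mkord addrC.
  under eq_bigr => i _ do rewrite /F -addrA.
  by rewrite big_split /= sumr_const card_ord mulr_natr.
rewrite mulrDl mulfK //=; move: hW; move: (_ / _)%R (W _ _ _) => X w; lra.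
Qed.

End Eval.

(** * Bounds on the expected time *)

Section Bounds.
Variables (R : realType) (d : nat) (H G : rooted_tree) (c0 : config).
Hypotheses (d_gt1 : 1 < d) (hH : max_children d H) (hG : max_children d G).
Hypothesis (inp : is_input H G c0).
Local Open Scope ring_scope.

Lemma safe_start (W : nat -> 'I_(nv H) -> 'I_(nv G) -> R) k :
  (forall j u v, shallow j.+1 u ->
    20 + (\sum_(o <- orders d (degH u) (degG v))
           \sum_(q <- queries (degH u) (degG v) (kids u v) o [::]) kid_cost W j u v q)
         / (size (orders d (degH u) (degG v)))%:R <= W j.+1 u v) ->
  shallow k (root H) ->
  safe (prog d) (subtree_iso H G) c0 (W k (root H) (root G) + 5).
Proof.
move=> hW shk; case: c0 inp => p r m [/= -> [locH [locG [sH sG r0 r1]]]].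
have d_gt0 : (0 < d)%N by lia.
have a0 : addr d Start = 0%N by rewrite /addr index_head muln0.
have ll : Start \in labels d by rewrite mem_head.
have -> : Config 0 r m = Config (addr d Start + 0) r m by rewrite a0.
apply: (safe_straight (is_ := take 4 (code d Start)) ll); [by []|by []|by []|].
apply: (safe_jump (t := addr d Entry) ll); [by []|by []|rewrite /=].
have -> : (W k (root H) (root G) + 5 - 4%:R - 1 = W k (root H) (root G) + 0)%R by lra.
set m' := upd m _ _; set r' := upd _ _ _.
have m'E : m' (r 2 + 2)%N = (addr d Start + 5)%N by rewrite /m' /upd /= eqxx.
apply: (safe_entry d_gt0 hH hG sH sG hW shk (s := r 2%N)).
  split=> //.
  - by move=> x xf; rewrite /m' /upd /= ltn_eqF // ltn_addr.
  - by rewrite /r' /upd /=; lia.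
move=> r2 m2 _ _ _ _; rewrite m'E -addnA.
apply: (safe_halt (b := emb (root H) (root G))) => //.
  by rewrite fetch //; case: emb.
exact: iff_sym (emb_root H G).
Qed.

Definition level_cost (k : nat) : R :=
  iter k (fun w => 20 + growth R d * (13 + w)) 0.

Lemma growth_ge2 : 2 <= growth R d.
Proof.
have : (2 <= d%:R :> R)%R by rewrite ler_nat.
by rewrite /growth => d2; nra.
Qed.

(** The term [- 1] strengthens the induction: since [growth] is at least 2, it absorbs the additive
    constant of each level. *)
Lemma level_cost_le k :
  level_cost k.+1 <= (20 + 13 * growth R d) * (2 * growth R d ^+ k - 1).
Proof.
have g2 := growth_ge2; elim: k => [|k IH]; first by rewrite /level_cost /= expr0; lra.
rewrite /level_cost iterS -/(level_cost k.+1) exprS.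
move: g2 IH; set g := growth R d; set x := level_cost _; set e := _ ^+ k => g2 IH.
have h1 : g * x <= g * ((20 + 13 * g) * (2 * e - 1)) by rewrite ler_wpM2l //; lra.
have h2 : 0 <= (20 + 13 * g) * (g - 2) by rewrite mulr_ge0; lra.
apply: (@le_trans _ _ (20 + 13 * g + g * x)); first by rewrite mulrDr; lra.
by apply: (le_trans (lerD (lexx _) h1)); nra.
Qed.

Lemma level_cost_ge j u v :
  20 + (\sum_(o <- orders d (degH u) (degG v))
         \sum_(q <- queries (degH u) (degG v) (kids u v) o [::])
           kid_cost (fun k (_ : 'I_(nv H)) (_ : 'I_(nv G)) => level_cost k) j u v q)
       / (size (orders d (degH u) (degG v)))%:R <= level_cost j.+1.
Proof.
have so : 0 < (size (orders d (degH u) (degG v)))%:R :> R.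
  by rewrite ltr0n size_orders; case: ifP => // _; lia.
have sq := sum_queries R (kids u v) d_gt1 (hH u) (hG v).
have l0 k : 0 <= level_cost k.
  elim: k => [|k IH]; first exact: lexx.
  rewrite /level_cost iterS -/(level_cost k); have := growth_ge2.
  by move: (growth R d) (level_cost k) IH => g x x0 g2; rewrite addr_ge0 ?mulr_ge0; lra.
rewrite [level_cost j.+1]iterS -/(level_cost j) lerD2l ler_pdivrMr //.
rewrite [leRHS]mulrAC; under eq_bigr => o _ do
  rewrite /kid_cost /= big_const_seq count_predT iter_addr_0 -[_ *+ size _]mulr_natl.
rewrite -mulr_suml -natr_sum ler_wpM2r // addr_ge0 //; exact: ler0n.
Qed.

Definition area_cost : R := 20 + 13 * d%:R ^+ 2.

(** The queried pairs are distinct, so by [card_below] their areas sum to at most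
    [(x - 1) * (y - 1)], where [x] and [y] are the sizes of the two subtrees. The difference to
    [x * y] is at least 1 and pays for the at most [d^2] calls made here. *)
Lemma area_cost_ge (u : 'I_(nv H)) (v : 'I_(nv G)) :
  20 + (\sum_(o <- orders d (degH u) (degG v))
         \sum_(q <- queries (degH u) (degG v) (kids u v) o [::])
           kid_cost (fun _ u v => area_cost * (#|below u| * #|below v|)%:R) 0 u v q)
       / (size (orders d (degH u) (degG v)))%:R <=
  area_cost * (#|below u| * #|below v|)%:R.
Proof.
have aux (x y : R) : 1 <= x -> 1 <= y ->
    20 + (13 * d%:R ^+ 2 + area_cost * ((x - 1) * (y - 1))) <= area_cost * (x * y).
  move=> x1 y1; have k0 : 0 <= 13 * d%:R ^+ 2 :> R by rewrite mulr_ge0 ?exprn_ge0.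
  by rewrite /area_cost; move: (13 * _) k0 => k k0; nra.
set a := degH u; set b := degG v; set os := orders d a b.
have ad : (a <= d)%N by exact: hH.
have bd : (b <= d)%N by exact: hG.
have so : 0 < (size os)%:R :> R.
  by rewrite ltr0n size_orders; case: ifP => // _; lia.
have C0 : 0 <= area_cost by rewrite /area_cost addr_ge0 // mulr_ge0 ?exprn_ge0 ?ler0n.
pose B := 13 * d%:R ^+ 2 +
  area_cost * ((#|below u|%:R - 1) * (#|below v|%:R - 1)) : R.
have hB o : o \in os ->
    \sum_(q <- queries a b (kids u v) o [::])
      kid_cost (fun _ u v => area_cost * (#|below u| * #|below v|)%:R) 0 u v q
    <= B.
  case/orders_pairs => uo mo; set qs := queries _ _ _ _ _.
  have uq : uniq qs by rewrite /qs queries_take take_uniq.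
  have sub : {subset qs <= [seq (i, j) | i <- iota 0 a, j <- iota 0 b]}.
    move=> [i j]; rewrite /qs queries_take => /mem_take; rewrite mo => /andP[ia jb].
    by apply: allpairs_f; rewrite mem_iota.
  rewrite /kid_cost big_split /= lerD //.
    rewrite big_const_seq count_predT iter_addr_0 -[_ *+ size _]mulr_natr ler_wpM2l //.
    rewrite -natrX ler_nat (leq_trans (uniq_leq_size uq sub)) //.
    by rewrite size_allpairs !size_iota leq_mul.
  rewrite -big_distrr -natr_sum /= ler_wpM2l //.
  have h : (leq (\sum_(q <- qs) #|below (kidH u q.1)| * #|below (kidG v q.2)|)
     ((\sum_(c <- children u) #|below c|) * (\sum_(c <- children v) #|below c|)))%N.
    have <- : (\sum_(q <- [seq (i, j) | i <- iota 0 a, j <- iota 0 b])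
        #|below (kidH u q.1)| * #|below (kidG v q.2)| =
      (\sum_(c <- children u) #|below c|) * (\sum_(c <- children v) #|below c|))%N.
      rewrite big_allpairs_dep /= [in RHS](big_nth (root H)).
      by rewrite [X in _ = (_ * X)%N](big_nth (root G)) big_distrlr /= /index_iota !subn0.
    apply: (uniq_sub_le_big leqnn (fun x y => leq_addr y x) _ _ uq _ sub).
    by apply: allpairs_uniq; rewrite ?iota_uniq // => -[? ?] [? ?].
  apply: (@le_trans _ _ ((#|below u|.-1 * #|below v|.-1)%N)%:R); last first.
    rewrite natrM -!subn1 !natrB ?lexx //; apply: leq_trans (card_below _); by [].
  rewrite ler_nat (leq_trans h) // leq_mul // -ltnS prednK ?card_below //.
    exact: leq_trans (card_below u).
  exact: leq_trans (card_below v).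
have hs : \sum_(o <- os) \sum_(q <- queries a b (kids u v) o [::])
    kid_cost (fun (_ : nat) u v => area_cost * (#|below u| * #|below v|)%:R) 0 u v q
    <= B * (size os)%:R.
  rewrite big_seq_cond.
  apply: (@le_trans _ _ (\sum_(o <- os | (o \in os) && true) B)).
    by apply: ler_sum => o /andP[/hB].
  by rewrite -big_seq_cond big_const_seq count_predT iter_addr_0 mulr_natr.
rewrite -ler_pdivrMr // in hs; apply: le_trans (lerD (lexx _) hs) _.
have cu : 1 <= #|below u|%:R :> R by rewrite ler1n (leq_trans _ (card_below u)).
have cv : 1 <= #|below v|%:R :> R by rewrite ler1n (leq_trans _ (card_below v)).
by rewrite /B natrM; apply: aux.
Qed.

End Bounds.

(** Take logarithms: multiplying the bound on [h] by [ln (growth R d)] turns [ln (d^2)] into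
    [2 * ln d], which leaves the stated exponent. *)
Lemma powR_growth_le (R : realType) (d n h : nat) (eps : R) : (2 <= d)%N -> (0 < n)%N ->
  (h%:R <= (ln (d%:R ^+ 2) / ln (growth R d) - eps) * (ln n%:R / ln d%:R))%R ->
  (growth R d ^+ h <= n%:R `^ (2%:R - eps * ln (growth R d) / ln d%:R))%R.
Proof.
move=> d2 n0 hh; have d2R : (2 <= d%:R :> R)%R by rewrite ler_nat.
have g1 : (1 < growth R d)%R by rewrite /growth; nra.
have [lg ld] : (0 < ln (growth R d))%R /\ (0 < ln d%:R :> R)%R.
  by split; apply: ln_gt0 => //; lra.
have nR : (0 < n%:R :> R)%R by rewrite ltr0n.
rewrite -powR_mulrn; last lra.
rewrite /powR gt_eqF ?gt_eqF //; last lra.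
rewrite ler_expR -(ler_pM2r lg) in hh *.
apply: (le_trans hh); rewrite lnXn; last lra.
rewrite -mulr_natl le_eqVlt; apply/orP; left; apply/eqP.
by field; rewrite mulr1 !gt_eqF.
Qed.

Theorem theorem1p4 (R : realType) (d : nat) (hd : (2 <= d)%N) :
  exists P : program,
    [/\ forall (H G : rooted_tree) (c0 : config),
          max_children d H -> max_children d G -> is_input H G c0 ->
          always_answers P c0 (subtree_iso H G),
        forall a : nat, exists C : R, forall (n h : nat) (H G : rooted_tree)
            (c0 : config),
          (nv H <= a * n)%N -> (nv G <= a * n)%N ->
          max_children d H -> max_children d G ->
          height_le h H -> height_le h G -> is_input H G c0 ->
          (expected_time R P c0 <=
             (C * Num.min (growth R d ^+ h) (n%:R ^+ 2))%R%:E)%E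
      & forall eps : R, (0 < eps)%R -> exists2 delta : R, (0 < delta)%R &
          forall a : nat, exists C : R, forall (n h : nat) (H G : rooted_tree)
              (c0 : config),
            (nv H <= a * n)%N -> (nv G <= a * n)%N ->
            max_children d H -> max_children d G ->
            height_le h H -> height_le h G ->
            (h%:R <= (ln (d%:R ^+ 2) / ln (growth R d) - eps)
                     * (ln n%:R / ln d%:R))%R ->
            is_input H G c0 ->
            (expected_time R P c0 <= (C * n%:R `^ (2%:R - delta))%R%:E)%E].
Proof.
have g2 := growth_ge2 R hd; set g := growth R d in g2 *.
have area0 : (0 <= area_cost R d)%R.
  by rewrite /area_cost addr_ge0 // mulr_ge0 ?exprn_ge0 ?ler0n.
(* The sum of the constants of the two bounds, so that it serves whichever term is the minimum. *)
pose C (a : nat) : R := (2 * (20 + 13 * g) + 5 + (area_cost R d * a%:R ^+ 2 + 5))%R.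
have C0 a : (0 <= C a)%R.
  by rewrite /C !addr_ge0 // ?mulr_ge0 ?exprn_ge0 ?ler0n //; lra.
have nv_gt0 (T : rooted_tree) a n : (nv T <= a * n)%N -> (0 < n)%N.
  case: n => //; rewrite muln0 leqn0 => /eqP E.
  by have := ltn_ord (root T); rewrite {2}E.
have bound a n h H G c0 : (nv H <= a * n)%N -> (nv G <= a * n)%N ->
    max_children d H -> max_children d G -> height_le h H -> is_input H G c0 ->
    (expected_time R (prog d) c0 <= (C a * Num.min (g ^+ h) (n%:R ^+ 2))%R%:E)%E.
  move=> Hn Gn hH hG hh inp.
  have g1 : (1 <= g ^+ h)%R by apply: exprn_ege1; lra.
  have n1 : (1 <= n%:R ^+ 2 :> R)%R.
    by apply: exprn_ege1; rewrite ler1n; exact: nv_gt0 Hn.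
  have C1 : (0 <= area_cost R d * a%:R ^+ 2)%R by rewrite mulr_ge0 ?exprn_ge0.
  rewrite /Num.min; case: ifP => _.
    have := safe_start hd hH hG inp
      (W := fun k _ _ => level_cost R d k)
      (fun j u v _ => level_cost_ge R hd hH hG j u v) (shallow_height hh).
    move/expected_time_le/le_trans; apply; rewrite lee_fin.
    have := level_cost_le R hd h; rewrite -/g /C.
    by move: (level_cost _ _ _) (g ^+ h)%R g1 => w e e1; nra.
  have := safe_start hd hH hG inp
    (W := fun (_ : nat) u v => (area_cost R d * (#|below u| * #|below v|)%:R)%R)
    (fun _ u v _ => area_cost_ge R hd hH hG u v) (shallow_nv H).
  move/expected_time_le/le_trans; apply; rewrite lee_fin.
  have le1 : ((#|below (root H)| * #|below (root G)|)%:R <= a%:R ^+ 2 * n%:R ^+ 2 :> R)%R.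
    rewrite -!natrX -natrM ler_nat -expnMn -mulnn.
    by apply: leq_mul; rewrite (leq_trans (max_card _)) ?card_ord.
  have := ler_wpM2l area0 le1; rewrite /C mulrA.
  by move: (_ * _%:R)%R (area_cost R d * _)%R (n%:R ^+ 2)%R C1 n1 => w x e x0 e1; nra.
exists (prog d); split.
(* No height is given here; the number of vertices serves as the recursion level. *)
- move=> H G c0 hH hG inp.
  by have [] := safe_start hd hH hG inp
    (W := fun k _ _ => level_cost R d k)
    (fun j u v _ => level_cost_ge R hd hH hG j u v) (shallow_nv H).
- move=> a; exists (C a) => n h H G c0 Hn Gn hH hG hh _ inp.
  exact: bound Hn Gn hH hG hh inp.
move=> eps eps0; have d2R : (2 <= d%:R :> R)%R by rewrite ler_nat.
exists (eps * ln g / ln d%:R)%R.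
  by rewrite divr_gt0 ?mulr_gt0 // ln_gt0 //; lra.
move=> a; exists (C a) => n h H G c0 Hn Gn hH hG hh _ hle inp.
apply: (le_trans (bound _ _ _ _ _ _ Hn Gn hH hG hh inp)).
rewrite lee_fin ler_wpM2l // (le_trans _ (powR_growth_le hd (nv_gt0 _ _ _ Hn) hle)) //.
by rewrite ge_min lexx.
Qed.
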